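(* Consider an instance of the two-machine flow shop problem $F2\,||\,C_{\max}$ with $n=n_A+n_B$ jobs, indexed $1,\dots,n$ according to Johnson's sequence, where jobs $1,\dots,n_A$ belong to set $A$ and jobs $n_A+1,\dots,n$ belong to set $B$. If $P_1\le P_2-p^{\max}_{B2}$, let $k_A$ denote the smallest index such that $$\sum_{i\in A:\ p_{1,i}\le p_{1,k_A}} p_{1,i}\ \le\ \sum_{i\in A:\ p_{1,i}\le p_{1,k_A}} p_{2,i}\;-\;p^{\max}_{A1}\qquad\text{and}\qquad p_{1,k_A}<p_{1,k_A+1}.$$ Then, an optimal schedule is obtained by first sequencing set $A$, with jobs $1,\dots,k_A$ in Johnson's order and jobs $k_A+1,\dots,n_A$ in any order, followed by set $B$ sequenced in any order. Moreover, if $k_A\log k_A\le n$, then an optimal solution to problem $F2\,||\,C_{\max}$ can be computed in linear time.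
   Context: Two-machine flow shop problem $F2\,||\,C_{\max}$: a set $\{1,\dots,n\}$ of jobs must be processed on two machines $M_1$ and $M_2$ in this order; job $j$ requires a processing time $p_{1,j}$ on $M_1$ and $p_{2,j}$ on $M_2$. All jobs are available at time $0$, each machine can process at most one job at a time, and preemption is not allowed. The objective is to minimize the makespan $C_{\max}$, i.e. the completion time of the last job on $M_2$. A sequence of the jobs defines the permutation schedule in which both machines process the jobs in that order, each operation starting as early as possible; there always exists an optimal schedule that is a permutation schedule. Johnson's sequence (Johnson's order): let $A$ be the set of jobs with $p_{1,j}\le p_{2,j}$ and $B$ the set of jobs with $p_{1,j}>p_{2,j}$; first schedule the jobs of $A$ in nondecreasing order of $p_{1,j}$, and then the jobs of $B$ in nonincreasing order of $p_{2,j}$. It is assumed, without loss of generality, that the jobs are indexed so that Johnson's sequence is $1,2,\dots,n$, with $A=\{1,\dots,n_A\}$ and $B=\{n_A+1,\dots,n\}$; this indexing is notational, and an algorithm receives the pairs $(p_{1,j},p_{2,j})$ without their being already sorted. Linear time means $O(n)$ time. Notation: $P_1=\sum_{i=1}^n p_{1,i}$ and $P_2=\sum_{i=1}^n p_{2,i}$ are the total processing times on $M_1$ and $M_2$; $p^{\max}_{A1}$ is the largest processing time in subset $A$ on machine $M_1$; $p^{\max}_{B2}$ is the largest processing time in subset $B$ on machine $M_2$. *)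

(* Defs.v *)
From HB Require Import structures.
From mathcomp Require Import all_boot all_order all_algebra all_fingroup.
From mathcomp Require Import reals exp.

Set Implicit Arguments.
Unset Strict Implicit.
Unset Printing Implicit Defensive.

Import Order.TTheory GRing.Theory Num.Theory.
Local Open Scope ring_scope.

(** * The problem F2 || Cmax *)

(* Job j of the mathematical text (1 <= j <= n) is the ordinal of value j - 1. *)
Record instance (R : realType) (n : nat) := Instance {
  p1 : 'I_n -> R;
  p2 : 'I_n -> R;
  p1_ge0 : forall j, 0 <= p1 j;
  p2_ge0 : forall j, 0 <= p2 j }.

(* Start times on M1 and on M2; no permutation structure is imposed. *)
Record schedule (R : realType) (n : nat) := Schedule {
  start1 : 'I_n -> R;
  start2 : 'I_n -> R }.

Definition one_at_a_time (R : realType) (n : nat) (p S : 'I_n -> R) : Prop :=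
  forall i j, i != j -> S i + p i <= S j \/ S j + p j <= S i.

Definition feasible (R : realType) (n : nat) (I : instance R n)
    (S : schedule R n) : Prop :=
  [/\ forall j, 0 <= start1 S j,
      forall j, start1 S j + p1 I j <= start2 S j,
      one_at_a_time (p1 I) (start1 S)
    & one_at_a_time (p2 I) (start2 S)].

Definition makespan (R : realType) (n : nat) (I : instance R n)
    (S : schedule R n) : R :=
  \big[Num.max/0]_(j < n) (start2 S j + p2 I j).

Definition optimal (R : realType) (n : nat) (I : instance R n)
    (S : schedule R n) : Prop :=
  feasible I S /\ forall S', feasible I S' -> makespan I S <= makespan I S'.

(* Start times of j when s is processed as early as possible on machines that
   become free at times t1 and t2; the value for j \notin s is irrelevant. *)
Fixpoint earliest_starts (R : realType) (n : nat) (I : instance R n)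
    (t1 t2 : R) (s : seq 'I_n) (j : 'I_n) : R * R :=
  if s is i :: s' then
    let c1 := t1 + p1 I i in
    let b2 := Num.max c1 t2 in
    if i == j then (t1, b2) else earliest_starts I c1 (b2 + p2 I i) s' j
  else (t1, t2).

Definition permutation_schedule (R : realType) (n : nat) (I : instance R n)
    (s : seq 'I_n) : schedule R n :=
  Schedule (fun j => (earliest_starts I 0 0 s j).1)
           (fun j => (earliest_starts I 0 0 s j).2).

Definition optimal_sequence (R : realType) (n : nat) (I : instance R n)
    (s : seq 'I_n) : Prop :=
  perm_eq s (enum 'I_n) /\ optimal I (permutation_schedule I s).

(** * Johnson's sequence and the index k_A *)

Definition setA (R : realType) (n : nat) (I : instance R n) : {set 'I_n} :=
  [set j | p1 I j <= p2 I j].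

Definition setB (R : realType) (n : nat) (I : instance R n) : {set 'I_n} :=
  [set j | p1 I j > p2 I j].

(* Ties may be broken in any way. *)
Definition johnson_sequence (R : realType) (n : nat) (I : instance R n)
    (s : seq 'I_n) : Prop :=
  exists sA sB : seq 'I_n,
    [/\ s = sA ++ sB,
        perm_eq sA (enum (setA I)), sorted (fun i j => p1 I i <= p1 I j) sA,
        perm_eq sB (enum (setB I)) & sorted (fun i j => p2 I i >= p2 I j) sB].

Definition johnson_indexed (R : realType) (n : nat) (I : instance R n) : Prop :=
  johnson_sequence I (enum 'I_n).

(* Job j of [relabel I sigma] is job [sigma j] of I. *)
Definition relabel (R : realType) (n : nat) (I : instance R n)
    (sigma : {perm 'I_n}) : instance R n :=
  Instance (fun j => p1_ge0 I (sigma j)) (fun j => p2_ge0 I (sigma j)).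

Definition total1 (R : realType) (n : nat) (I : instance R n) : R :=
  \sum_(j < n) p1 I j.

Definition total2 (R : realType) (n : nat) (I : instance R n) : R :=
  \sum_(j < n) p2 I j.

(* The maximum over an empty set of jobs is 0. *)
Definition pmaxA1 (R : realType) (n : nat) (I : instance R n) : R :=
  \big[Num.max/0]_(j in setA I) p1 I j.

Definition pmaxB2 (R : realType) (n : nat) (I : instance R n) : R :=
  \big[Num.max/0]_(j in setB I) p2 I j.

(* The last clause is p_{1,k} < p_{1,k+1}, where job k+1 has to be in A: when k
   is the last job of A, p_{1,k+1} is read as +oo. *)
Definition kA_condition (R : realType) (n : nat) (I : instance R n)
    (k : 'I_n) : Prop :=
  [/\ k \in setA I,
      \sum_(i in setA I | p1 I i <= p1 I k) p1 I i
        <= \sum_(i in setA I | p1 I i <= p1 I k) p2 I i - pmaxA1 I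
    & forall k' : 'I_n, val k' = (val k).+1 -> k' \in setA I ->
        p1 I k < p1 I k'].

(* The integer k_A of the mathematical text is [k.+1]. *)
Definition is_kA (R : realType) (n : nat) (I : instance R n) (k : 'I_n) : Prop :=
  kA_condition I k /\ forall j, kA_condition I j -> (k <= j)%N.

(** * Programs and their running time

   A structured unit-cost random access machine.  Its memory consists of
   arrays of natural numbers (used as indices and counters) and arrays of real
   numbers (used as data); a scalar variable is cell 0 of an array.  Both sorts
   have addition, subtraction (truncated on indices) and comparisons only:
   there is no multiplication, rounding, or conversion between the sorts.  A
   program has no real constant other than 0 and mentions finitely many arrays.
   Every node of an evaluated expression and every executed command or loop
   test costs one unit. *)

Record state (R : realType) := State {
  nmem : nat -> nat -> nat;
  rmem : nat -> nat -> R }.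

Inductive nexp :=
  | NConst of nat
  | NGet of nat & nexp
  | NAdd of nexp & nexp
  | NSub of nexp & nexp.

Inductive rexp :=
  | RZero
  | RGet of nat & nexp
  | RAdd of rexp & rexp
  | RSub of rexp & rexp.

Inductive bexp :=
  | NLe of nexp & nexp
  | RLe of rexp & rexp
  | BNot of bexp
  | BAnd of bexp & bexp.

Inductive cmd :=
  | Skip
  | NSet of nat & nexp & nexp
  | RSet of nat & nexp & rexp
  | Seq of cmd & cmd
  | If of bexp & cmd & cmd
  | While of bexp & cmd.

Fixpoint neval (R : realType) (st : state R) (e : nexp) : nat :=
  match e with
  | NConst m => m
  | NGet a i => nmem st a (neval st i)
  | NAdd e1 e2 => (neval st e1 + neval st e2)%N
  | NSub e1 e2 => (neval st e1 - neval st e2)%N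
  end.

Fixpoint reval (R : realType) (st : state R) (e : rexp) : R :=
  match e with
  | RZero => 0
  | RGet a i => rmem st a (neval st i)
  | RAdd e1 e2 => reval st e1 + reval st e2
  | RSub e1 e2 => reval st e1 - reval st e2
  end.

Fixpoint beval (R : realType) (st : state R) (b : bexp) : bool :=
  match b with
  | NLe e1 e2 => (neval st e1 <= neval st e2)%N
  | RLe e1 e2 => reval st e1 <= reval st e2
  | BNot b1 => ~~ beval st b1
  | BAnd b1 b2 => beval st b1 && beval st b2
  end.

Fixpoint ncost (e : nexp) : nat :=
  match e with
  | NConst _ => 1
  | NGet _ i => (ncost i).+1
  | NAdd e1 e2 | NSub e1 e2 => (ncost e1 + ncost e2).+1
  end.

Fixpoint rcost (e : rexp) : nat :=
  match e with
  | RZero => 1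
  | RGet _ i => (ncost i).+1
  | RAdd e1 e2 | RSub e1 e2 => (rcost e1 + rcost e2).+1
  end.

Fixpoint bcost (b : bexp) : nat :=
  match b with
  | NLe e1 e2 => (ncost e1 + ncost e2).+1
  | RLe e1 e2 => (rcost e1 + rcost e2).+1
  | BNot b1 => (bcost b1).+1
  | BAnd b1 b2 => (bcost b1 + bcost b2).+1
  end.

Definition update (T : Type) (m : nat -> nat -> T) (a i : nat) (v : T) :
    nat -> nat -> T :=
  fun a' i' => if (a' == a) && (i' == i) then v else m a' i'.

(* [exec c st t st']: from st, the program c halts in st' after t units. *)
Inductive exec (R : realType) : cmd -> state R -> nat -> state R -> Prop :=
  | ExecSkip st : exec Skip st 1 st
  | ExecNSet st a i e :
      exec (NSet a i e) st (ncost i + ncost e).+1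
        (State (update (nmem st) a (neval st i) (neval st e)) (rmem st))
  | ExecRSet st a i e :
      exec (RSet a i e) st (ncost i + rcost e).+1
        (State (nmem st) (update (rmem st) a (neval st i) (reval st e)))
  | ExecSeq c1 c2 st st1 st2 t1 t2 :
      exec c1 st t1 st1 -> exec c2 st1 t2 st2 ->
      exec (Seq c1 c2) st (t1 + t2).+1 st2
  | ExecIfTrue b c1 c2 st st1 t :
      beval st b -> exec c1 st t st1 ->
      exec (If b c1 c2) st (bcost b + t).+1 st1
  | ExecIfFalse b c1 c2 st st1 t :
      ~~ beval st b -> exec c2 st t st1 ->
      exec (If b c1 c2) st (bcost b + t).+1 st1
  | ExecWhileTrue b c st st1 st2 t1 t2 :
      beval st b -> exec c st t1 st1 -> exec (While b c) st1 t2 st2 ->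
      exec (While b c) st (bcost b + t1 + t2).+1 st2
  | ExecWhileFalse b c st :
      ~~ beval st b -> exec (While b c) st (bcost b).+1 st.

(* n is in cell 0 of index array 0, the processing times on M1 and M2 are in
   data arrays 0 and 1; the rest of the memory is arbitrary. *)
Definition holds_input (R : realType) (n : nat) (I : instance R n)
    (st : state R) : Prop :=
  [/\ nmem st 0 0 = n,
      forall j : 'I_n, rmem st 0 j = p1 I j
    & forall j : 'I_n, rmem st 1 j = p2 I j].

(* The first n cells of index array 1 list the (0-based) jobs of s. *)
Definition holds_output (R : realType) (n : nat) (s : seq 'I_n)
    (st : state R) : Prop :=
  mkseq (nmem st 1) n = map val s.

Definition logb (R : realType) (b x : R) : R := ln x / ln b.

(* Main.v *)
Require Import Defs.
From mathcomp Require Import all_boot all_order all_algebra all_fingroup.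
From mathcomp Require Import reals exp.
From mathcomp Require Import lra zify.

(** The makespan of the permutation schedule of a sequence is the length of a
    longest path: the work on M1 of the jobs up to some job u, then the work on
    M2 of the jobs from u on.  With P2 the total work on M2, this length is

      P2 + p1 u + sum over the jobs i before u of (p1 i - p2 i).

    Consider a sequence that starts with some smallest jobs of A, sorted by p1,
    whose gain, the sum of their p2 - p1, is at least the largest p1 in A;
    continues with the rest of A in any order; and ends with B in any order.
    - If u is in the sorted prefix, then the length is a lower bound on the
      makespan of every schedule ([johnson_bound_le_makespan]).
    - If u is in the rest of A, then the gain of the prefix absorbs p1 u, and
      the length is at most P2.
    - If u is in B, then counting from the end gives at most the total work on
      M1 plus the largest p2 in B, which is at most P2 by hypothesis.
    As P2 is itself a lower bound, the sequence is optimal ([prefix_optimal]).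
    Jobs 1, ..., k_A form such a prefix by definition.

    For the running time, k_A need not be found.  A tournament tree on the p1
    of the jobs of A is built in time O(n); its champion is extracted until the
    gain is large enough; then the rest of A and B are listed.  Since jobs
    1, ..., k_A have enough gain, at most k_A extractions occur ([kA_progress]),
    and each one replays O(log n) matches.  Finally k log n = O(n) as soon as
    k log k <= n ([leq_mul_trunc_log]): log n is O(sqrt n) when k <= sqrt n, and
    at most 2 log k otherwise. *)

Import Order.TTheory GRing.Theory Num.Theory.
Local Open Scope ring_scope.

Set Implicit Arguments.
Unset Strict Implicit.
Unset Printing Implicit Defensive.

(** * Lower bounds on the makespan *)

(** Induction on the number of jobs, removing the positive job that starts last.
    Jobs of length zero are dropped: one of them may start together with a
    positive job, so that starting last would not mean running last. *)
Lemma packing (R : realType) (n : nat) (p S : 'I_n -> R) (E : {set 'I_n})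
    (a b : R) :
  (forall j, 0 <= p j) -> one_at_a_time p S -> a <= b ->
  (forall j, j \in E -> a <= S j) -> (forall j, j \in E -> S j + p j <= b) ->
  \sum_(j in E) p j <= b - a.
Proof.
move=> p_ge0 disj.
have [m] := ubnP #|E|; elim: m E b => // m IH E b leEm le_ab startE endE.
have [pos0|] := boolP [forall j in E, p j == 0].
  rewrite big1 ?subr_ge0 // => j jE.
  by apply/eqP; move/forall_inP: pos0; apply.
rewrite negb_forall => /existsP[j0]; rewrite negb_imply => /andP[j0E pj0].
pose Q j := (j \in E) && (p j != 0).
have Qj0 : Q j0 by rewrite /Q j0E.
case: (Order.TotalTheory.arg_maxP S Qj0) => i /andP[iE pi_neq0] imax.
have pi_gt0 : 0 < p i by rewrite lt_def pi_neq0 p_ge0.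
rewrite (big_setID (E :\ i)) /= [X in _ + X <= _](_ : _ = p i); last first.
  rewrite (_ : E :\: (E :\ i) = [set i]) ?big_set1 //.
  apply/setP => j; rewrite !inE; case: (j =P i) => [->|_] /=; first by rewrite iE.
  by rewrite andNb.
rewrite (_ : E :&: (E :\ i) = E :\ i); last first.
  by apply/setIidPr; apply: subsetDl.
pose E' := [set j in E :\ i | p j != 0].
have -> : \sum_(j in E :\ i) p j = \sum_(j in E') p j.
  rewrite (bigID (fun j => p j == 0)) /= big1 ?add0r => [|j /andP[_ /eqP]//].
  by apply: eq_bigl => j; rewrite !inE.
have E'P j : j \in E' -> [/\ j != i, j \in E & 0 < p j].
  by rewrite !inE lt_def p_ge0 andbT => /andP[/andP[-> ->] ->].
suff : \sum_(j in E') p j <= S i - a.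
  move=> h; have := endE i iE; move: h.
  set x := \sum_(j in E') _; set y := p i; lra.
apply: IH => [|||j jE'].
- apply: leq_trans (_ : #|E| <= m)%N; last by rewrite -ltnS.
  apply: leq_ltn_trans (_ : #|E :\ i| < #|E|)%N; last by rewrite [X in (_ < X)%N](cardsD1 i) iE.
  by apply/subset_leq_card/subsetP => j; rewrite !inE => /andP[/andP[-> ->]].
- exact: startE.
- by move=> j /E'P[_ jE _]; apply: startE.
have [ji jE pj] := E'P j jE'.
case: (disj j i ji) => // ov.
have Qj : Q j by rewrite /Q jE gt_eqF.
have := imax j Qj; rewrite /=; move: ov pi_gt0; set y := p i; lra.
Qed.

Section Bounds.
Context {R : realType} {n : nat} (I : instance R n).
Implicit Types (S : schedule R n) (s : seq 'I_n).

Lemma completion_le_makespan S j : start2 S j + p2 I j <= makespan I S.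
Proof. exact: (le_bigmax _ (fun j => start2 S j + p2 I j)). Qed.

Lemma makespan_ge0 S : 0 <= makespan I S.
Proof. by rewrite /makespan; apply: bigmax_ge_id. Qed.

Lemma total2_le_makespan S : feasible I S -> total2 I <= makespan I S.
Proof.
move=> [S1_ge0 S12 _ disj2].
have := @packing _ _ _ _ setT 0 (makespan I S) (p2_ge0 I) disj2 (makespan_ge0 S).
rewrite subr0 /total2 (eq_bigl xpredT) => [|j]; last by rewrite inE.
apply=> j _; last exact: completion_le_makespan.
have := S1_ge0 j; have := S12 j; have := p1_ge0 I j; lra.
Qed.

(** Let v be, among the jobs with p1 v >= p1 u, the first one on M1.  The jobs E
    that start on M2 before v leaves M1 precede v on M1, so they have p1 < p1 u
    and their work on M1 fits before v; all other work on M2 comes after v has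
    left M1.  Hence the makespan is at least P2 + p1 v + sum over E of (p1 - p2),
    where jobs of B count positively, while jobs of A are in L and count
    negatively, so that this sum is at least the sum over L.  The case p1 u = 0
    is apart: there, a job j of E with p1 j = 0 does not satisfy p1 j < p1 u. *)
Lemma johnson_bound_le_makespan S (u : 'I_n) (L : {set 'I_n}) :
  feasible I S -> L \subset setA I ->
  (forall j, j \in setA I -> p1 I j < p1 I u -> j \in L) ->
  total2 I + p1 I u + \sum_(j in L) (p1 I j - p2 I j) <= makespan I S.
Proof.
move=> feasS /subsetP LA smallL.
have excessL j : j \in L -> p1 I j - p2 I j <= 0.
  by move/LA; rewrite inE subr_le0.
have [u0|u_neq0] := eqVneq (p1 I u) 0.
  apply: le_trans (total2_le_makespan feasS); rewrite u0 addr0.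
  by rewrite gerDl; apply: sumr_le0.
have [S1_ge0 S12 disj1 disj2] := feasS.
have u_gt0 : 0 < p1 I u by rewrite lt_def u_neq0 p1_ge0.
have Qu : p1 I u <= p1 I u by [].
case: (@Order.TotalTheory.arg_minP _ _ _ u (fun j => p1 I u <= p1 I j)
  (start1 S) Qu) => v uv vmin.
pose C := start1 S v + p1 I v.
pose E := [set j | start2 S j < C].
have E_before j : j \in E -> start1 S j + p1 I j <= start1 S v.
  rewrite inE => jC; have := S12 j; have [jv|jv] := eqVneq j v.
    by move: jC; rewrite /C jv => ? ?; exfalso; lra.
  case: (disj1 j v jv) => // ov; have := p1_ge0 I j; move: jC; rewrite /C => ? ? ?; exfalso; lra.
have E_short j : j \in E -> p1 I j < p1 I u.
  move=> jE; rewrite ltNge; apply/negP => uj.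
  by have := vmin j uj; have := E_before j jE; lra.
have pack1 : \sum_(j in E) p1 I j <= start1 S v.
  by rewrite -[leRHS]subr0; apply: packing (p1_ge0 I) disj1 _ _ _.
have vE : v \notin E by rewrite inE -leNgt S12.
have pack2 : \sum_(j in ~: E) p2 I j <= makespan I S - C.
  apply: packing (p2_ge0 I) disj2 _ _ _ => [|j|j _].
  - apply: le_trans (completion_le_makespan S v).
    by have := S12 v; have := p2_ge0 I v; rewrite /C; lra.
  - by rewrite !inE -leNgt.
  - exact: completion_le_makespan.
have -> : total2 I = \sum_(j in E) p2 I j + \sum_(j in ~: E) p2 I j.
  by rewrite /total2 (bigID (mem E)) /=; congr (_ + _); apply: eq_bigl => j; rewrite !inE.
have excessE : \sum_(j in L) (p1 I j - p2 I j)
    <= \sum_(j in E) p1 I j - \sum_(j in E) p2 I j.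
  rewrite -sumrB (bigID (mem E)) /= [leRHS](bigID (mem L)) /=.
  apply: lerD.
    by rewrite le_eqVlt; apply/orP; left; apply/eqP/eq_bigl => j; rewrite andbC.
  apply: (@le_trans _ _ 0); first by apply: sumr_le0 => j /andP[/excessL].
  apply: sumr_ge0 => j /andP[jE jL]; rewrite subr_ge0 ltW // ltNge.
  by apply: contra jL => jA; apply: smallL (E_short j jE); rewrite inE.
move: pack2; rewrite /C; move: pack1 excessE uv.
by rewrite /=; lra.
Qed.

Lemma earliest_starts_ge t1 t2 s j :
  t1 <= (earliest_starts I t1 t2 s j).1 /\ t2 <= (earliest_starts I t1 t2 s j).2.
Proof.
elim: s t1 t2 => [|i s IH] t1 t2 //=.
case: eqP => _ /=; first by split; rewrite ?le_max ?lexx ?orbT.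
have [h1 h2] := IH (t1 + p1 I i) (Num.max (t1 + p1 I i) t2 + p2 I i).
have := p1_ge0 I i; have := p2_ge0 I i.
have : t2 <= Num.max (t1 + p1 I i) t2 by rewrite le_max lexx orbT.
by split; [move: h1|move: h2]; lra.
Qed.

Lemma earliest_starts_precedence t1 t2 s j : j \in s ->
  (earliest_starts I t1 t2 s j).1 + p1 I j <= (earliest_starts I t1 t2 s j).2.
Proof.
elim: s t1 t2 => [|i s IH] t1 t2 //=; rewrite inE eq_sym.
by case: eqP => [->|_] /= js; [rewrite le_max lexx | apply: IH].
Qed.

Lemma earliest_starts_disjoint t1 t2 s :
  (forall i j, i \in s -> j \in s -> i != j ->
    let e := earliest_starts I t1 t2 s in
    ((e i).1 + p1 I i <= (e j).1 \/ (e j).1 + p1 I j <= (e i).1) /\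
    ((e i).2 + p2 I i <= (e j).2 \/ (e j).2 + p2 I j <= (e i).2)).
Proof.
elim: s t1 t2 => [|h s IH] t1 t2 //= i j.
set c1 := t1 + _; set c2 := _ + p2 I h.
rewrite !inE !(eq_sym _ h).
case: (h =P i) => [<-|_] /=; case: (h =P j) => [<-|_] //=.
- by move=> _ _ _; have [? ?] := earliest_starts_ge c1 c2 s j; split; left.
- by move=> _ _ _; have [? ?] := earliest_starts_ge c1 c2 s i; split; right.
- exact: IH.
Qed.

Lemma permutation_schedule_feasible s :
  (forall j, j \in s) -> feasible I (permutation_schedule I s).
Proof.
move=> sT; split=> [j|j|i j ij|i j ij] /=.
- by have [] := earliest_starts_ge 0 0 s j.
- exact: earliest_starts_precedence.
- by have [] := @earliest_starts_disjoint 0 0 s i j (sT i) (sT j) ij.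
- by have [] := @earliest_starts_disjoint 0 0 s i j (sT i) (sT j) ij.
Qed.

(** Going back in time from the completion of j, either M2 has been busy since
    t2, or it became busy at the moment when some job u left M1, and M1 has been
    busy since t1. *)
Lemma completion_le_critical M t1 t2 s j :
  (forall a u r, s = a ++ u :: r ->
    t1 + \sum_(i <- a) p1 I i + p1 I u + p2 I u + \sum_(i <- r) p2 I i <= M) ->
  t2 + \sum_(i <- s) p2 I i <= M -> j \in s ->
  (earliest_starts I t1 t2 s j).2 + p2 I j <= M.
Proof.
elim: s t1 t2 => [|h s IH] t1 t2 //= crit; rewrite big_cons => idle.
have s_ge0 : 0 <= \sum_(i <- s) p2 I i by apply: sumr_ge0 => i _; apply: p2_ge0.
have := crit [::] h s erefl; rewrite big_nil => head.
have maxM : Num.max (t1 + p1 I h) t2 + p2 I h + \sum_(i <- s) p2 I i <= M.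
  by rewrite -addrA -lerBrDr ge_max; apply/andP; split; move: head idle; lra.
rewrite inE eq_sym; case: (h =P j) => [<- _|_ /= js] /=.
  by move: maxM s_ge0; lra.
apply: IH => // a u r def_s.
have := crit (h :: a) u r; rewrite def_s big_cons => /(_ erefl).
by rewrite addrA.
Qed.

End Bounds.

(** * Optimality of a sorted prefix of A with enough gain *)

Lemma split_cat (T : Type) (s t a r : seq T) (u : T) :
  s ++ t = a ++ u :: r ->
  (exists r', s = a ++ u :: r' /\ r = r' ++ t) \/
  (exists a', a = s ++ a' /\ t = a' ++ u :: r).
Proof.
elim: s a => [|x s IH] a /=; first by right; exists a.
case: a => [|y a] /= [-> eq_st]; first by left; exists s.
case: (IH _ eq_st) => [[r' [-> ->]]|[a' [-> ->]]].
  by left; exists r'.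
by right; exists a'.
Qed.

Lemma perm_enum_setAB (R : realType) n (I : instance R n) sA sB :
  perm_eq sA (enum (setA I)) -> perm_eq sB (enum (setB I)) ->
  perm_eq (sA ++ sB) (enum 'I_n).
Proof.
move=> pA pB; have mA := perm_mem pA; have mB := perm_mem pB.
apply: uniq_perm; [|exact: enum_uniq|] => [|j]; last first.
  by rewrite mem_cat mA mB !mem_enum !inE ltNge orbN.
rewrite cat_uniq (perm_uniq pA) (perm_uniq pB) !enum_uniq andbT /=.
apply/hasPn => j; rewrite mA mB !mem_enum !inE => ?.
by rewrite -ltNge.
Qed.

(** Rewriting the length of the critical path at u as
    P2 + p1 u + sum over the jobs before u of (p1 - p2) leaves one case for each
    of the three blocks that may contain u. *)
Lemma prefix_optimal (R : realType) n (I : instance R n) s1 s2 sB :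
  total1 I <= total2 I - pmaxB2 I ->
  perm_eq (s1 ++ s2) (enum (setA I)) -> perm_eq sB (enum (setB I)) ->
  sorted (fun i j => p1 I i <= p1 I j) s1 ->
  (forall i j, i \in s1 -> j \in s2 -> p1 I i <= p1 I j) ->
  pmaxA1 I <= \sum_(i <- s1) (p2 I i - p1 I i) ->
  optimal_sequence I (s1 ++ s2 ++ sB).
Proof.
move=> totals pA pB sorted1 le12 slack.
have pAB : perm_eq (s1 ++ s2 ++ sB) (enum 'I_n).
  by rewrite catA; apply: perm_enum_setAB pA pB.
have sT j : j \in s1 ++ s2 ++ sB by rewrite (perm_mem pAB) mem_enum.
have memA j : (j \in s1 ++ s2) = (j \in setA I) by rewrite (perm_mem pA) mem_enum.
split=> //; split; first exact: permutation_schedule_feasible.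
move=> S feasS; have P2M := total2_le_makespan feasS.
have total_split F : \sum_(j < n) F j = \sum_(j <- s1 ++ s2 ++ sB) F j :> R.
  by rewrite (perm_big _ pAB) big_enum.
have sumA_le0 s : {subset s <= setA I} -> \sum_(j <- s) (p1 I j - p2 I j) <= 0.
  move=> sA; rewrite big_seq; apply: sumr_le0 => j /sA.
  by rewrite inE subr_le0.
apply: bigmax_le => [|j _]; first exact: makespan_ge0.
apply: completion_le_critical (sT j) => [a u r def_s|]; last first.
  by rewrite add0r -total_split.
have -> : 0 + \sum_(i <- a) p1 I i + p1 I u + p2 I u + \sum_(i <- r) p2 I i =
    total2 I + p1 I u + \sum_(i <- a) (p1 I i - p2 I i).
  rewrite /total2 total_split def_s big_cat big_cons sumrB /=; lra.
case: (split_cat def_s) => [[r' [def_s1 def_r]]|[a2 [def_a def_tail]]].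
  have uniq1 : uniq (s1 ++ s2) by rewrite (perm_uniq pA) enum_uniq.
  have ua : uniq a by move: uniq1; rewrite def_s1 -catA cat_uniq; case/and3P.
  have aA : {subset a <= setA I}.
    by move=> i ia; rewrite -memA def_s1 !mem_cat ia.
  have <- : \sum_(j in [set j in a]) (p1 I j - p2 I j)
      = \sum_(j <- a) (p1 I j - p2 I j).
    rewrite -big_enum; apply/perm_big/uniq_perm; rewrite ?enum_uniq // => i.
    by rewrite mem_enum inE.
  apply: johnson_bound_le_makespan feasS _ _.
    by apply/subsetP => i; rewrite inE => /aA.
  move=> i; rewrite -memA mem_cat inE => /orP[|is2]; last first.
    by rewrite ltNge le12 // def_s1 mem_cat mem_head orbT.
  rewrite def_s1 mem_cat => /orP[//|iur]; rewrite ltNge.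
  move: sorted1; rewrite sorted_pairwise => [|x y z]; last exact: le_trans.
  rewrite def_s1 pairwise_cat /= => /and3P[_ _ /andP[/allP ur _]].
  by move: iur; rewrite inE => /orP[/eqP->|/ur ->]; rewrite ?lexx.
case: (split_cat def_tail) => [[r' [def_s2 def_r]]|[a3 [def_a2 def_sB]]].
  apply: le_trans P2M.
  have umax : p1 I u <= pmaxA1 I.
    apply: (le_bigmax_cond _ (fun j => p1 I j)).
    by rewrite -memA def_s2 !mem_cat mem_head !orbT.
  have a2A : {subset a2 <= setA I}.
    by move=> i ia; rewrite -memA def_s2 !mem_cat ia orbT.
  rewrite def_a big_cat /=; have := sumA_le0 _ a2A.
  have -> : \sum_(i <- s1) (p1 I i - p2 I i) = - \sum_(i <- s1) (p2 I i - p1 I i).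
    by rewrite -sumrN; apply: eq_bigr => i _; rewrite opprB.
  move: umax slack; set x := \sum_(i <- s1) _; set y := \sum_(i <- a2) _; lra.
apply: le_trans P2M.
have memB i : i \in u :: r -> p2 I i < p1 I i.
  have <- : (i \in setB I) = (p2 I i < p1 I i) by rewrite inE.
  by rewrite -[i \in setB I]mem_enum -(perm_mem pB) def_sB mem_cat => ->; rewrite orbT.
have umax : p2 I u <= pmaxB2 I.
  apply: (le_bigmax_cond _ (fun j => p2 I j)).
  by rewrite inE memB // mem_head.
have : 0 <= \sum_(i <- r) (p1 I i - p2 I i).
  rewrite big_seq; apply: sumr_ge0 => i ir; rewrite subr_ge0 ltW // memB //.
  by rewrite inE ir orbT.
have : total1 I - total2 I = \sum_(i <- a) (p1 I i - p2 I i)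
    + (p1 I u - p2 I u + \sum_(i <- r) (p1 I i - p2 I i)).
  by rewrite /total1 /total2 -sumrB total_split def_s big_cat big_cons.
move: totals umax; set x := \sum_(i <- a) _; set y := \sum_(i <- r) _; lra.
Qed.

Lemma johnson_indexed_initial (R : realType) n (I : instance R n) :
  johnson_indexed I -> exists2 m, (forall j : 'I_n, (j \in setA I) = (j < m)%N)
  & forall i j : 'I_n, (i <= j)%N -> (j < m)%N -> p1 I i <= p1 I j.
Proof.
move=> [sA [sB [def_s pA sortA pB _]]].
have inA (k : 'I_n) : (k \in setA I) = (k < size sA)%N.
  have := nth_ord_enum k k; rewrite def_s nth_cat.
  case: ltnP => [ks|ks] kE.
    by rewrite -mem_enum -(perm_mem pA) -kE mem_nth.
  have : k \in sB.
    rewrite -kE mem_nth // ltn_subLR //.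
    by rewrite -size_cat -def_s size_enum_ord.
  by rewrite (perm_mem pB) mem_enum !inE ltNge => /negbTE.
exists (size sA) => // i j ij jA; have iA := leq_ltn_trans ij jA.
have nthA (k : 'I_n) : (k < size sA)%N -> nth i sA k = k.
  by move=> kA; have := nth_ord_enum i k; rewrite def_s nth_cat kA.
rewrite -{1}(nthA i iA) -(nthA j jA).
by apply: (sorted_leq_nth _ _ i sortA) => // x y z; apply: le_trans.
Qed.

(** The strict inequality between p1 at k and at k + 1 makes the jobs of A that
    are not longer than k on M1 exactly the jobs up to k, ties included. *)
Lemma kA_prefix (R : realType) n (I : instance R n) (k : 'I_n) :
  johnson_indexed I -> kA_condition I k ->
  forall j, (j \in setA I) && (p1 I j <= p1 I k) = (j <= k)%N.
Proof.
move=> /johnson_indexed_initial[m inA sortedA] [kA _ next] j.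
rewrite inA; rewrite inA in kA; apply/andP/idP => [[jm jk]|jk]; last first.
  by split; [apply: leq_ltn_trans jk kA | apply: sortedA].
rewrite leqNgt; apply/negP => lt_kj.
have kn : (k.+1 < n)%N by apply: leq_ltn_trans lt_kj _.
have := next (Ordinal kn) erefl; rewrite inA (leq_ltn_trans lt_kj jm).
move=> /(_ isT); rewrite ltNge => /negP; apply.
by apply: le_trans jk; apply: sortedA.
Qed.

Lemma johnson_prefix_optimal (R : realType) (n : nat) (I : instance R n) (kA : 'I_n) :
  johnson_indexed I ->
  total1 I <= total2 I - pmaxB2 I ->
  is_kA I kA ->
  forall sA sB : seq 'I_n,
    perm_eq sA [seq j : 'I_n <- enum (setA I) | (kA < j)%N] ->
    perm_eq sB (enum (setB I)) ->
    optimal_sequence I ([seq j : 'I_n <- enum 'I_n | (j <= kA)%N] ++ sA ++ sB).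
Proof.
move=> indexed totals [kA_cond _] sA sB pA pB.
have prefixP := kA_prefix indexed kA_cond.
have [kA_A slack _] := kA_cond.
have [m inA sortedA] := johnson_indexed_initial indexed.
have indexed_below (j : 'I_n) : (j <= kA)%N -> j \in setA I.
  by rewrite -prefixP => /andP[].
have memA j : (j \in sA) = (j \in setA I) && (kA < j)%N.
  by rewrite (perm_mem pA) mem_filter mem_enum andbC.
apply: prefix_optimal => //.
- apply: uniq_perm => [||j]; [|exact: enum_uniq|].
    rewrite cat_uniq (perm_uniq pA) !filter_uniq -?enumT ?enum_uniq ?andbT //=.
    apply/hasPn => j; rewrite memA mem_filter => /andP[_].
    by rewrite ltnNge => /negbTE ->.
  rewrite mem_cat memA mem_filter !mem_enum andbT -prefixP.
  rewrite ltnNge -prefixP; case: (j \in setA I) => //=.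
  by rewrite orbN.
- apply: (@sub_in_sorted _ [pred j : 'I_n | (j <= kA)%N] (relpre val leq)).
  + move=> i j _ jk ij; apply: sortedA => //.
    by rewrite -inA; apply: indexed_below.
  + exact: filter_all.
  + apply: sorted_filter => [x y z|]; first exact: leq_trans.
    by rewrite -sorted_map val_enum_ord iota_sorted.
- move=> i j; rewrite mem_filter memA => /andP[ik _] /andP[jA kj].
  by apply: sortedA; [apply: leq_trans ik (ltnW kj) | rewrite -inA].
rewrite big_filter big_enum_cond /= sumrB.
under eq_bigl => j do rewrite -prefixP.
under [X in _ - X]eq_bigl => j do rewrite -prefixP.
by move: slack; lra.
Qed.

Local Open Scope nat_scope.

(** * Execution with a time bound *)

(** Total correctness with a bound on the running time. *)
Definition runs (R : realType) (c : cmd) (st : state R) (t : nat)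
    (Q : state R -> Prop) : Prop :=
  exists t' st', [/\ exec c st t' st', t' <= t & Q st'].

Fixpoint straight (c : cmd) : bool :=
  match c with
  | Seq c1 c2 | If _ c1 c2 => straight c1 && straight c2
  | While _ _ => false
  | _ => true
  end.

(** Loop-free programs denote functions on states, which reduces reasoning on
    them to computation; the value on a loop is a dummy. *)
Fixpoint run (R : realType) (c : cmd) (st : state R) : state R :=
  match c with
  | NSet a i e =>
      State (update (nmem st) a (neval st i) (neval st e)) (rmem st)
  | RSet a i e =>
      State (nmem st) (update (rmem st) a (neval st i) (reval st e))
  | Seq c1 c2 => run c2 (run c1 st)
  | If b c1 c2 => if beval st b then run c1 st else run c2 st
  | _ => st
  end.

Fixpoint cost (c : cmd) : nat :=
  match c with
  | NSet _ i e => (ncost i + ncost e).+1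
  | RSet _ i e => (ncost i + rcost e).+1
  | Seq c1 c2 => (cost c1 + cost c2).+1
  | If b c1 c2 => (bcost b + maxn (cost c1) (cost c2)).+1
  | _ => 1
  end.

Section Runs.
Context {R : realType}.
Implicit Types (st : state R) (Q : state R -> Prop).

Lemma runs_straight c st Q :
  straight c -> Q (run c st) -> runs c st (cost c) Q.
Proof.
move=> sc Qst; suff [t ext le_t] : exists2 t, exec c st t (run c st) & t <= cost c.
  by exists t, (run c st).
elim: c st sc {Q Qst} => //=.
- by move=> st; exists 1 => //; constructor.
- by move=> a i e st _; eexists; first exact: ExecNSet.
- by move=> a i e st _; eexists; first exact: ExecRSet.
- move=> c1 IH1 c2 IH2 st /andP[/(IH1 st)[t1 ex1 le1] /(IH2 (run c1 st))[t2 ex2 le2]].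
  by exists (t1 + t2).+1; [apply: ExecSeq ex1 ex2 | rewrite ltnS leq_add].
- move=> b c1 IH1 c2 IH2 st /andP[/(IH1 st)[t1 ex1 le1] /(IH2 st)[t2 ex2 le2]].
  case: ifP => [bT|/negbT bF].
    exists (bcost b + t1).+1; first exact: ExecIfTrue.
    by rewrite ltnS leq_add2l leq_max le1.
  exists (bcost b + t2).+1; first exact: ExecIfFalse.
  by rewrite ltnS leq_add2l leq_max le2 orbT.
Qed.

Lemma runs_seq c1 c2 st t1 t2 Q :
  runs c1 st t1 (fun st1 => runs c2 st1 t2 Q) ->
  runs (Seq c1 c2) st (t1 + t2).+1 Q.
Proof.
move=> [t1' [st1 [ex1 le1 [t2' [st2 [ex2 le2 Q2]]]]]].
exists (t1' + t2').+1, st2; split=> //; last by rewrite ltnS leq_add.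
exact: ExecSeq ex1 ex2.
Qed.

Lemma runs_weaken c st t t' (Q Q' : state R -> Prop) :
  t <= t' -> (forall st', Q st' -> Q' st') -> runs c st t Q -> runs c st t' Q'.
Proof.
move=> le_t QQ' [t1 [st1 [ex1 le1 Q1]]]; exists t1, st1.
by split=> //; [apply: leq_trans le_t | apply: QQ'].
Qed.

Definition while_cost (b : bexp) (t m : nat) : nat := (bcost b + t).+1 * m.+1.

(** The argument m of the invariant is a bound on the number of remaining
    iterations; the loop may stop before m reaches 0. *)
Lemma runs_while b c t (Inv : nat -> state R -> Prop) :
  (forall m st, Inv m st -> beval st b ->
     exists2 m', m = m'.+1 & runs c st t (Inv m')) ->
  forall m st, Inv m st ->
    runs (While b c) st (while_cost b t m)
      (fun st' => ~~ beval st' b /\ exists m', Inv m' st').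
Proof.
move=> step; elim=> [|m IH] st inv.
  case bst: (beval st b); first by have [] := step 0 st inv bst.
  exists (bcost b).+1, st; split; [|rewrite /while_cost; lia|].
    by apply: ExecWhileFalse; rewrite bst.
  by split; [rewrite bst | exists 0].
case bst: (beval st b).
  have [_ [<-] [t1 [st1 [ex1 le1 inv1]]]] := step m.+1 st inv bst.
  have [t2 [st2 [ex2 le2 Q2]]] := IH st1 inv1.
  exists (bcost b + t1 + t2).+1, st2; split=> //.
    exact: ExecWhileTrue ex1 ex2.
  by move: le2; rewrite /while_cost; lia.
exists (bcost b).+1, st; split; [|rewrite /while_cost; lia|].
  by apply: ExecWhileFalse; rewrite bst.
by split; [rewrite bst | exists m.+1].
Qed.

End Runs.

(** * Tournament trees

   The tree has nodes 1, ..., 2n - 1; the sons of a node i < n are 2i and 2i + 1,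
   and the leaves are n, ..., 2n - 1, for any n, not only powers of 2.  A node
   holds the winner of the match between its sons: an index below n with the
   smallest key, where a value that is not below n stands for no contestant. *)

Section Tournament.
Context {R : realType} (n : nat) (key : nat -> R).

Definition winner (a b : nat) : nat :=
  if (a < n) && ~~ ((b < n) && ~~ (key a <= key b)%R) then a else b.

Definition played (T : nat -> nat) (i : nat) : Prop :=
  T i = winner (T (i + i)) (T (i + i + 1)).

Lemma winner_choice a b : winner a b = a \/ winner a b = b.
Proof. by rewrite /winner; case: ifP; [left | right]. Qed.

Lemma winner_beats a b x : x \in [:: a; b] -> x < n ->
  winner a b < n /\ (key (winner a b) <= key x)%R.
Proof.
rewrite /winner !inE => /orP[]/eqP-> lt_n.
  rewrite lt_n /=; case: (ltnP b n) => //= lt_bn.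
  by rewrite negbK; case: leP => // /ltW.
rewrite lt_n /=; case: (ltnP a n) => //= lt_an; rewrite negbK.
by case: leP.
Qed.

Variable T : nat -> nat.
Hypothesis played_all : forall i, 0 < i < n -> played T i.

(** Induction along the path from x to the root. *)
Lemma champion_beats x : 0 < x < n + n -> T x < n ->
  T 1 < n /\ (key (T 1) <= key (T x))%R.
Proof.
have [m] := ubnP x; elim: m x => // m IH x ltxm /andP[x_gt0 ltx] Tx.
have [x1|x_neq1] := eqVneq x 1; first by rewrite x1 in Tx *.
have half_ok : 0 < x./2 < n by lia.
have xE : T x \in [:: T (x./2 + x./2); T (x./2 + x./2 + 1)].
  have [e|e] : x = x./2 + x./2 \/ x = x./2 + x./2 + 1 by lia.
    by rewrite -e mem_head.
  by rewrite !inE -e eqxx orbT.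
have [w_n le_w] := winner_beats xE Tx.
rewrite -(played_all half_ok) in w_n le_w.
have [||T1 le1] := IH x./2 _ _ w_n; [lia|lia|].
by split=> //; apply: le_trans le1 le_w.
Qed.

(** Follow the winner of each match down from the root. *)
Lemma champion_leaf : 0 < n -> exists2 j, j < n & T (n + j) = T 1.
Proof.
move=> n_gt0; suff leafP m i : i + m = n + n -> 0 < i -> 0 < m ->
    exists2 j, j < n & T (n + j) = T i.
  by apply: (@leafP (n + n).-1) => //; lia.
have [M] := ubnP m; elim: M i m => // M IH i m ltmM im i_gt0 m_gt0.
have [le_ni|lt_in] := leqP n i.
  by exists (i - n); [lia | rewrite subnKC].
have [e|e] := winner_choice (T (i + i)) (T (i + i + 1)).
  have [||||j jn jE] := IH (i + i) (m - i); [lia..|].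
  by exists j => //; rewrite jE (@played_all i) ?i_gt0 // e.
have [||||j jn jE] := IH (i + i + 1) (m - i - 1); [lia..|].
by exists j => //; rewrite jE (@played_all i) ?i_gt0 // e.
Qed.

End Tournament.

Lemma mkseq_update (T : Type) (f g : nat -> T) (k : nat) (v : T) :
  (forall i, f i = if i == k then v else g i) ->
  mkseq f k.+1 = rcons (mkseq g k) v.
Proof.
move=> fE; rewrite /mkseq -addn1 iotaD map_cat cats1 /= fE eqxx.
congr rcons; apply/eq_in_map => i; rewrite mem_iota fE => /andP[_].
by case: eqP => // ->; rewrite add0n ltnn.
Qed.

(** * The program *)

(* Arrays of indices: the number of jobs, the output, the nodes of the tree and
   the parents of these nodes, the loop counter, the length of the output, the
   node whose match is being replayed, and the job just extracted.  Arrays of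
   reals: the processing times, the gain of the extracted jobs, and the largest
   processing time on M1 in A. *)
Local Notation aN := 0 (only parsing).
Local Notation aOut := 1 (only parsing).
Local Notation aTree := 2 (only parsing).
Local Notation aParent := 3 (only parsing).
Local Notation aI := 4 (only parsing).
Local Notation aLen := 5 (only parsing).
Local Notation aCur := 6 (only parsing).
Local Notation aWin := 7 (only parsing).
Local Notation rP1 := 0 (only parsing).
Local Notation rP2 := 1 (only parsing).
Local Notation rGain := 2 (only parsing).
Local Notation rMax := 3 (only parsing).

Definition nscal (a : nat) : nexp := NGet a (NConst 0).
Definition rscal (a : nat) : rexp := RGet a (NConst 0).
Definition set_nscal (a : nat) (e : nexp) : cmd := NSet a (NConst 0) e.
Definition set_rscal (a : nat) (e : rexp) : cmd := RSet a (NConst 0) e.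
Definition succ_exp (e : nexp) : nexp := NAdd e (NConst 1).
Definition nlt (e1 e2 : nexp) : bexp := NLe (succ_exp e1) e2.
Definition in_A : bexp := RLe (RGet rP1 (nscal aI)) (RGet rP2 (nscal aI)).
Definition next_job : cmd := set_nscal aI (succ_exp (nscal aI)).
Definition more_jobs : bexp := nlt (nscal aI) (nscal aN).

(** The leaf of a job outside A gets the value n, which stands for no contestant. *)
Definition load_job : cmd :=
  If in_A
    (Seq (NSet aTree (NAdd (nscal aN) (nscal aI)) (nscal aI))
         (If (RLe (RGet rP1 (nscal aI)) (rscal rMax)) Skip
             (set_rscal rMax (RGet rP1 (nscal aI)))))
    (NSet aTree (NAdd (nscal aN) (nscal aI)) (nscal aN)).

(** The root gets parent 0, which ends the replay along a path to the root. *)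
Definition init : cmd :=
  Seq (set_nscal aI (NConst 0))
 (Seq (set_nscal aLen (NConst 0))
 (Seq (NSet aParent (NConst 1) (NConst 0))
 (Seq (set_rscal rGain RZero)
      (set_rscal rMax RZero)))).

Definition load : cmd := Seq init (While more_jobs (Seq load_job next_job)).

Definition play (e : nexp) : cmd :=
  let l := NGet aTree (NAdd e e) in
  let r := NGet aTree (succ_exp (NAdd e e)) in
  If (BAnd (nlt l (nscal aN))
           (BNot (BAnd (nlt r (nscal aN)) (BNot (RLe (RGet rP1 l) (RGet rP1 r))))))
     (NSet aTree e l) (NSet aTree e r).

(** Parents are tabulated because the machine cannot halve an index in unit time. *)
Definition build_step : cmd :=
  let i := nscal aI in
  Seq (set_nscal aI (NSub i (NConst 1)))
 (Seq (play i)
 (Seq (NSet aParent (NAdd i i) i)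
      (NSet aParent (succ_exp (NAdd i i)) i))).

Definition build : cmd := While (NLe (NConst 2) (nscal aI)) build_step.

Definition pop : cmd :=
  Seq (set_nscal aWin (NGet aTree (NConst 1)))
 (Seq (NSet aOut (nscal aLen) (nscal aWin))
 (Seq (set_nscal aLen (succ_exp (nscal aLen)))
 (Seq (set_rscal rGain
         (RAdd (rscal rGain)
               (RSub (RGet rP2 (nscal aWin)) (RGet rP1 (nscal aWin)))))
 (Seq (NSet aTree (NAdd (nscal aN) (nscal aWin)) (nscal aN))
      (set_nscal aCur (NGet aParent (NAdd (nscal aN) (nscal aWin)))))))).

Definition replay_step : cmd :=
  Seq (play (nscal aCur)) (set_nscal aCur (NGet aParent (nscal aCur))).

Definition replay : cmd := While (NLe (NConst 1) (nscal aCur)) replay_step.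

(** The comparison with the largest p1 in A replaces the knowledge of k_A. *)
Definition extract : cmd :=
  While (BNot (RLe (rscal rMax) (rscal rGain))) (Seq pop replay).

Definition collect_step (b : bexp) : cmd :=
  Seq (If b (Seq (NSet aOut (nscal aLen) (nscal aI))
                 (set_nscal aLen (succ_exp (nscal aLen)))) Skip)
      next_job.

Definition collect (b : bexp) : cmd :=
  Seq (set_nscal aI (NConst 0)) (While more_jobs (collect_step b)).

(** The leaves of extracted jobs have been emptied, so those that still hold their
    job list the rest of A. *)
Definition in_tree : bexp :=
  nlt (NGet aTree (NAdd (nscal aN) (nscal aI))) (nscal aN).

Definition schedule_prog : cmd :=
  Seq load (Seq build (Seq extract (Seq (collect in_tree) (collect (BNot in_A))))).

Section Correctness.
Context {R : realType}.
Context (n : nat) (k1 k2 : nat -> R).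
Implicit Types (st : state R).

Local Notation inA j := (k1 j <= k2 j)%R.

Definition holds_keys st : Prop :=
  [/\ nmem st aN 0 = n, rmem st rP1 = k1 & rmem st rP2 = k2].

Lemma run_play e x st : holds_keys st -> neval st e = x ->
  run (play e) st =
    State (update (nmem st) aTree x
             (winner n k1 (nmem st aTree (x + x)) (nmem st aTree (x + x + 1))))
          (rmem st).
Proof.
by move=> [nE kE _] /= ->; rewrite nE kE !addn1 /winner; case: ifP.
Qed.

Definition leaves (X : seq nat) (T : nat -> nat) : Prop :=
  forall j, j < n -> T (n + j) = if inA j && (j \notin X) then j else n.

Definition parents (P : nat -> nat) : Prop :=
  forall x, 0 < x < n + n -> P x = x./2.

Definition all_played (T : nat -> nat) : Prop :=
  forall i, 0 < i < n -> played n k1 T i.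

(** Up to i, mx bounds the processing times on M1 in A from above, and it does not
    exceed pm, which is to be their maximum. *)
Definition max_key (i : nat) (pm mx : R) : Prop :=
  [/\ (0 <= mx)%R, (mx <= pm)%R & forall j, j < i -> inA j -> (k1 j <= mx)%R].

Lemma load_runs st pm :
  holds_keys st -> max_key n pm pm ->
  runs load st (cost init + while_cost more_jobs (cost (Seq load_job next_job)) n).+1
    (fun st' => [/\ holds_keys st', nmem st' aI 0 = n, nmem st' aLen 0 = 0,
      nmem st' aParent 1 = 0 & rmem st' rGain 0 = 0%R] /\
      [/\ leaves [::] (nmem st' aTree) & max_key n pm (rmem st' rMax 0)]).
Proof.
move=> keys [pm_ge0 _ pm_ub]; apply/runs_seq/runs_straight => //.
pose Inv m st' := [/\ holds_keys st', nmem st' aI 0 + m = n, nmem st' aLen 0 = 0,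
  nmem st' aParent 1 = 0 & rmem st' rGain 0 = 0%R] /\
  [/\ forall j, j < nmem st' aI 0 ->
        nmem st' aTree (n + j) = if inA j then j else n
    & max_key (nmem st' aI 0) pm (rmem st' rMax 0)].
apply: (@runs_weaken _ _ _ _ _ _ _ (leqnn _)); last first.
  apply: (@runs_while _ _ _ _ Inv); last first.
    by split; split.
  move=> m st1 [[keys1 iE lenE parE gainE] [leavesE [mx_ge0 mx_le mx_ub]]].
  have [nE k1E k2E] := keys1.
  rewrite /= nE addn1 => lt_in; exists m.-1; first by lia.
  apply: runs_straight => //; rewrite /Inv /holds_keys.
  set i := nmem st1 aI 0 in iE leavesE mx_ub lt_in.
  rewrite /= k1E k2E -/i.
  have step j : j < i + 1 ->
    (if n + j == n + i then if inA i then i else n else nmem st1 aTree (n + j))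
    = if inA j then j else n.
    move=> ltj; rewrite eqn_add2l; case: eqP => [->//|/eqP ne_ji].
    by apply: leavesE; lia.
  case iA: (inA i).
    rewrite iA in step.
    rewrite /= /update /= ?k1E -/i ?nE; case: ifP => [le_mx|gt_mx] /=.
      split; split=> //; first by lia.
      split=> // j ltj jA; have [->//|ne_ji] := eqVneq j i.
      by apply: mx_ub => //; lia.
    have {}gt_mx : (rmem st1 rMax 0 < k1 i)%R by rewrite ltNge gt_mx.
    split; split=> //; first by lia.
    rewrite ?k1E; split=> [||j ltj jA].
    - exact: le_trans (ltW gt_mx).
    - by apply: pm_ub => //; lia.
    have [->//|ne_ji] := eqVneq j i.
    by apply: le_trans (ltW gt_mx); apply: mx_ub => //; lia.
  rewrite iA in step.
  rewrite /= /update /= -/i ?nE.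
  split; split=> //; first by lia.
  split=> // j ltj jA; have [ji|ne_ji] := eqVneq j i; first by rewrite ji iA in jA.
  by apply: mx_ub => //; lia.
move=> st' [/= done [m [[keys' iE lenE parE gainE] [leavesE mxE]]]].
have [nE _ _] := keys'.
have iN : nmem st' aI 0 = n by move: done; rewrite nE addn1; lia.
rewrite iN in leavesE mxE; split; split=> // j ltj.
by rewrite leavesE // andbT.
Qed.

Definition frame (arrays : seq nat) st st' : Prop :=
  rmem st' = rmem st /\ forall a, a \notin arrays -> nmem st' a = nmem st a.

Lemma frame_keys arrays st st' :
  frame arrays st st' -> aN \notin arrays -> holds_keys st -> holds_keys st'.
Proof. by move=> [rE nE] notN []; rewrite /holds_keys rE nE. Qed.

(** A match depends on its node and its two sons, so overwriting node i by its
    winner can only spoil the match at the parent of i. *)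
Lemma played_update (T T' : nat -> nat) i :
  (forall x, T' x = if x == i then winner n k1 (T (i + i)) (T (i + i + 1)) else T x) ->
  0 < i -> played n k1 T' i /\
  forall j, 0 < j -> j != i -> j != i./2 -> played n k1 T j -> played n k1 T' j.
Proof.
move=> TE i_gt0; split.
  by rewrite /played !TE eqxx; do 2!(case: eqP => [?|_]; first by lia).
move=> j j_gt0 ji ji2; rewrite /played !TE (negbTE ji) => ->.
by do 2!(case: eqP => [?|_]; first by lia).
Qed.

Lemma build_runs st :
  0 < n -> holds_keys st -> nmem st aI 0 = n -> nmem st aParent 1 = 0 ->
  runs build st (while_cost (NLe (NConst 2) (nscal aI)) (cost build_step) n)
    (fun st' => frame [:: aTree; aParent; aI] st st' /\
      [/\ forall x, n <= x -> nmem st' aTree x = nmem st aTree x,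
          all_played (nmem st' aTree) & parents (nmem st' aParent)]).
Proof.
move=> n_gt0 keys iE parE.
pose Inv m st' := [/\ frame [:: aTree; aParent; aI] st st',
  nmem st' aI 0 = m.+1, m < n & nmem st' aParent 1 = 0] /\
  [/\ forall x, n <= x -> nmem st' aTree x = nmem st aTree x,
      forall j, m < j < n -> played n k1 (nmem st' aTree) j
    & forall x, m.+1 + m.+1 <= x < n + n -> nmem st' aParent x = x./2].
apply: (@runs_weaken _ _ _ _ _ _ _ _ _ (@runs_while _ _ _ _ Inv _ n.-1 st _)).
- by rewrite /while_cost; apply: leq_mul => //; lia.
- move=> st' [/= done [m [[fr mE ltm par1] [leavesE playedE parentE]]]].
  have m0 : m = 0 by move: done; rewrite mE; lia.
  rewrite m0 in playedE parentE; split=> //; split=> // x /andP[x_gt0 ltx].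
  by have [->//|x_neq1] := eqVneq x 1; apply: parentE; lia.
- move=> m st1 [[fr mE ltm par1] [leavesE playedE parentE]].
  rewrite /= mE ltnS; case: m mE ltm playedE parentE => [//|m].
  move=> mE ltm playedE parentE _; exists m => //.
  apply: runs_straight => //.
  set st2 := run (set_nscal aI (NSub (nscal aI) (NConst 1))) st1.
  have keys2 : holds_keys st2.
    by have := frame_keys fr isT keys.
  have i2 : nmem st2 aI 0 = m.+1 by rewrite /st2 /= /update /= mE subn1.
  have -> : run build_step st1 =
      run (Seq (NSet aParent (NAdd (nscal aI) (nscal aI)) (nscal aI))
      (NSet aParent (succ_exp (NAdd (nscal aI) (nscal aI))) (nscal aI))) (run (play (nscal aI)) st2).
    by [].
  rewrite (@run_play (nscal aI) m.+1 st2 keys2 i2).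
  have [playedm played_other] := @played_update (nmem st2 aTree)
    (update (nmem st2) aTree m.+1 (winner n k1 (nmem st2 aTree (m.+1 + m.+1))
      (nmem st2 aTree (m.+1 + m.+1 + 1))) aTree) m.+1 (fun=> erefl) isT.
  split; split.
  + split; first by case: fr.
    move=> a aN; rewrite -(fr.2 a aN); move: aN; rewrite !inE /= /update /st2 /=.
    by case/norP=> /negPf-> /norP[/negPf-> /negPf->].
  + by rewrite /= /update /= mE subn1.
  + by lia.
  + by rewrite /= /update /= /update /= mE par1; do 2!(case: eqP => [?|_]; first by lia).
  + move=> x le_nx; rewrite -leavesE //= /update /=; case: eqP => [?|_] //.
    by lia.
  + move=> j /andP[ltmj ltjn]; have [->//|jm] := eqVneq j m.+1.
    by apply: played_other; [lia|lia|lia|apply: playedE; lia].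
  + move=> x /andP[lex ltx]; rewrite /= /update /= /update /= mE.
    case: eqP => [->|ne1]; first by lia.
    case: eqP => [->|ne2]; first by lia.
    by apply: parentE; lia.
split; split=> //; rewrite ?prednK //; try lia.
Qed.

(** One match at most is wrong, and each step moves it to the parent; as the
    index of the node is halved, l steps lead from below 2 ^ l to the root. *)
Lemma replay_runs st l :
  holds_keys st -> parents (nmem st aParent) ->
  nmem st aCur 0 < n -> nmem st aCur 0 < 2 ^ l ->
  (forall i, 0 < i < n -> i != nmem st aCur 0 -> played n k1 (nmem st aTree) i) ->
  runs replay st (while_cost (NLe (NConst 1) (nscal aCur)) (cost replay_step) l)
    (fun st' => [/\ frame [:: aTree; aCur] st st',
       forall x, n <= x -> nmem st' aTree x = nmem st aTree x
     & all_played (nmem st' aTree)]).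
Proof.
move=> keys parentsP cur_n cur_l played_st.
pose Inv m st' := [/\ frame [:: aTree; aCur] st st',
    forall x, n <= x -> nmem st' aTree x = nmem st aTree x,
    nmem st' aCur 0 < n, nmem st' aCur 0 < 2 ^ m
  & forall i, 0 < i < n -> i != nmem st' aCur 0 -> played n k1 (nmem st' aTree) i].
apply: (@runs_weaken _ _ _ _ _ _ _ (leqnn _) _ (@runs_while _ _ _ _ Inv _ l st _)).
- move=> st' [/= done [m [fr leavesE _ _ playedE]]]; split=> // i i_n.
  by apply: playedE => //; move: done i_n; lia.
- move=> m st1 [fr leavesE].
  set c := nmem st1 aCur 0 => c_n c_m playedE; rewrite /= -/c => c_gt0.
  case: m c_m => [|m c_m]; first by lia.
  exists m => //; apply: runs_straight => //.
  have keys1 := frame_keys fr isT keys.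
  have -> : run replay_step st1 = run (set_nscal aCur (NGet aParent (nscal aCur)))
      (run (play (nscal aCur)) st1) by [].
  rewrite (@run_play (nscal aCur) c st1 keys1 erefl).
  have [playedc played_other] := @played_update (nmem st1 aTree)
    (update (nmem st1) aTree c (winner n k1 (nmem st1 aTree (c + c))
      (nmem st1 aTree (c + c + 1))) aTree) c (fun=> erefl) c_gt0.
  have parc : nmem st1 aParent c = c./2.
    by rewrite fr.2 //; apply: parentsP; lia.
  split.
  + split; first by case: fr.
    move=> a aN; rewrite -(fr.2 a aN); move: aN; rewrite !inE /= /update /=.
    by case/norP=> /negPf-> /negPf->.
  + move=> x le_nx; rewrite -leavesE //= /update /=; case: eqP => [?|_] //.
    by lia.
  + by rewrite /= /update /= -/c parc; lia.
  + by rewrite /= /update /= -/c parc; move: c_m; rewrite expnS; lia.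
  + move=> i i_n; rewrite [nmem _ aCur 0]/= /update /= -/c parc => ic.
    have [->//|ne_ic] := eqVneq i c.
    by apply: played_other => //; [lia | apply: playedE].
by split.
Qed.

(** X is a beginning of A sorted by p1, for some way to break ties. *)
Definition lightest (X : seq nat) : Prop :=
  [/\ uniq X, all (fun x => (x < n) && inA x) X,
      sorted (fun x y => k1 x <= k1 y)%R X
    & forall x y, x \in X -> y < n -> inA y -> y \notin X -> (k1 x <= k1 y)%R].

Definition gain (X : seq nat) : R := (\sum_(x <- X) (k2 x - k1 x))%R.

Lemma lightest_rcons X w :
  lightest X -> w < n -> inA w -> w \notin X ->
  (forall y, y < n -> inA y -> y \notin X -> (k1 w <= k1 y)%R) ->
  lightest (rcons X w).
Proof.
move=> [uX allX sX lX] wn wA wX lw.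
have tr : transitive (fun x y => k1 x <= k1 y)%R by move=> x y z; apply: le_trans.
split.
- by rewrite rcons_uniq wX.
- by rewrite all_rcons wn wA.
- move: sX; rewrite !sorted_pairwise // pairwise_rcons => ->; rewrite andbT.
  by apply/allP => x xX; apply: lX.
move=> x y; rewrite !mem_rcons !inE negb_or => /orP[/eqP->|xX] yn yA /andP[_ yX].
  exact: lw.
exact: lX.
Qed.

Definition extracting (mx : R) (X : seq nat) st : Prop :=
  [/\ holds_keys st, all_played (nmem st aTree), parents (nmem st aParent)
    & leaves X (nmem st aTree)] /\
  [/\ mkseq (nmem st aOut) (size X) = X, nmem st aLen 0 = size X,
      rmem st rGain 0 = gain X, rmem st rMax 0 = mx & lightest X].

(** The champion is a lightest remaining job; emptying its leaf n + w affects no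
    match but the one at (n + w)./2. *)
Lemma pop_spec mx X st :
  extracting mx X st -> (exists2 y, y < n & inA y && (y \notin X)) ->
  exists w, [/\ w < n, lightest (rcons X w)
    & forall st', frame [:: aTree; aCur] (run pop st) st' ->
      (forall x, n <= x -> nmem st' aTree x = nmem (run pop st) aTree x) ->
      all_played (nmem st' aTree) -> extracting mx (rcons X w) st'] /\
  [/\ holds_keys (run pop st), parents (nmem (run pop st) aParent),
      nmem (run pop st) aCur 0 = (n + w)./2 &
      forall i, 0 < i < n -> i != (n + w)./2 ->
        played n k1 (nmem (run pop st) aTree) i].
Proof.
move=> [[keys playedT parentsP leavesT] [outE lenE gainE mxE lightX]] [y yn yX].
have [nE k1E k2E] := keys.
have leafA j : j < n -> inA j -> j \notin X -> nmem st aTree (n + j) = j.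
  by move=> jn jA jX; rewrite leavesT // jA jX.
have [|jw jn wE] := @champion_leaf _ n k1 (nmem st aTree) playedT; first by lia.
have beats j : j < n -> inA j -> j \notin X -> nmem st aTree 1 < n /\
    (k1 (nmem st aTree 1) <= k1 j)%R.
  move=> ltj jA jX; rewrite -(leafA j) //.
  by apply: (champion_beats playedT); rewrite ?leafA //; lia.
have [w_n _] : nmem st aTree 1 < n /\ (k1 (nmem st aTree 1) <= k1 y)%R.
  by case/andP: yX => ? ?; apply: beats.
move: wE w_n beats; set w := nmem st aTree 1 => wE w_n beats.
have /andP[wA wX] : inA w && (w \notin X).
  have := leavesT jw jn; rewrite wE; case: ifP => [jwA wjw|_ wn]; first by rewrite wjw.
  by move: w_n; rewrite wn ltnn.
exists w; split; split=> //.
- by apply: lightest_rcons => // z zn zA zX; case: (beats z zn zA zX).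
- move=> st' [rE fr] leaves' played'; split; split=> //.
  + by rewrite /holds_keys rE fr.
  + by rewrite fr.
  + move=> j ltj; rewrite leaves' ?leq_addr //= /update /= -/w nE eqn_add2l.
    rewrite mem_rcons inE negb_or; case: eqP => [_|_] /=; first by rewrite andbF.
    exact: leavesT.
  + rewrite fr // size_rcons -[in RHS]outE.
    by apply: mkseq_update => i; rewrite /= /update /= lenE.
  + by rewrite fr // /= /update /= lenE size_rcons addn1.
  + by rewrite rE /= /update /= gainE k1E k2E /gain -cats1 big_cat big_seq1.
  + by rewrite rE.
  + by apply: lightest_rcons => // z zn zA zX; case: (beats z zn zA zX).
- by rewrite /= /update /= -/w nE; apply: parentsP; lia.
move=> i i_n ne_iw; have := playedT i i_n; rewrite /played /= /update /= -/w nE.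
move=> ->; case: eqP => [?|_]; first by lia.
by do 2!(case: eqP => [?|_]; first by lia).
Qed.

(** K bounds the number of extractions: by hypothesis, a lightest X whose gain is
    still below mx has fewer than K jobs and leaves a job of A in the tree. *)
Lemma extract_runs mx K l st :
  extracting mx [::] st -> n <= 2 ^ l ->
  (forall X, lightest X -> (gain X < mx)%R ->
     size X < K /\ exists2 y, y < n & inA y && (y \notin X)) ->
  runs extract st (while_cost (BNot (RLe (rscal rMax) (rscal rGain)))
      (cost pop + while_cost (NLe (NConst 1) (nscal aCur)) (cost replay_step) l).+1 K)
    (fun st' => exists2 X, extracting mx X st' & (mx <= gain X)%R).
Proof.
move=> ext0 le_nl progress.
pose Inv m st' := exists2 X, extracting mx X st' & size X + m = K.
apply: (@runs_weaken _ _ _ _ _ _ _ (leqnn _) _ (@runs_while _ _ _ _ Inv _ K st _)).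
- move=> st' [/= done [m [X ext _]]]; exists X => //.
  by have [_ [_ _ <- <- _]] := ext; move: done; rewrite negbK.
- move=> m st1 [X ext sizeX] /=; have [_ [_ _ gE mxE lightX]] := ext.
  rewrite gE mxE -ltNge => lt_gm; have [ltK aliveX] := progress X lightX lt_gm.
  exists m.-1; first by lia.
  have [w [[wn lightw popped] [keysp parp curp playedp]]] := pop_spec ext aliveX.
  apply/runs_seq/runs_straight => //.
  have cur_n : nmem (run pop st1) aCur 0 < n by rewrite curp; lia.
  apply: runs_weaken (replay_runs (l := l) keysp parp cur_n _ _) => //.
  + move=> st' [fr leaves' played']; exists (rcons X w); first exact: popped.
    by rewrite size_rcons; lia.
  + exact: leq_trans cur_n le_nl.
  + by rewrite curp.
by exists [::].
Qed.

Lemma collect_runs b (p : pred nat) L st :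
  holds_keys st -> nmem st aLen 0 = size L -> mkseq (nmem st aOut) (size L) = L ->
  (forall st', frame [:: aOut; aI; aLen] st st' -> nmem st' aI 0 < n ->
     beval st' b = p (nmem st' aI 0)) ->
  runs (collect b) st
    (cost (set_nscal aI (NConst 0)) + while_cost more_jobs (cost (collect_step b)) n).+1
    (fun st' => [/\ frame [:: aOut; aI; aLen] st st',
       nmem st' aLen 0 = size (L ++ filter p (iota 0 n))
     & mkseq (nmem st' aOut) (size (L ++ filter p (iota 0 n)))
       = L ++ filter p (iota 0 n)]).
Proof.
move=> keys lenE outE bP; apply/runs_seq/runs_straight => //.
pose Inv m st' := let L' := L ++ filter p (iota 0 (nmem st' aI 0)) in
  [/\ frame [:: aOut; aI; aLen] st st', nmem st' aI 0 + m = n,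
      nmem st' aLen 0 = size L' & mkseq (nmem st' aOut) (size L') = L'].
apply: (@runs_weaken _ _ _ _ _ _ _ (leqnn _) _ (@runs_while _ _ _ _ Inv _ n _ _)).
- move=> st' [/= done [m [fr iE lenE' outE']]].
  have [nE _ _] := frame_keys fr isT keys.
  have iN : nmem st' aI 0 = n by move: done; rewrite nE addn1; lia.
  by rewrite iN in lenE' outE'.
- move=> m st1 [fr iE lenE' outE']; have [nE _ _] := frame_keys fr isT keys.
  rewrite /= nE addn1 => lt_in; exists m.-1; first by lia.
  apply: runs_straight => //.
  have := bP st1 fr lt_in; set i := nmem st1 aI 0 in iE lenE' outE' lt_in *.
  move=> bE; have iotaE : iota 0 (i + 1) = rcons (iota 0 i) i.
    by rewrite iotaD cats1.
  have frE st2 : rmem st2 = rmem st1 ->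
      (forall a, a \notin [:: aOut; aI; aLen] -> nmem st2 a = nmem st1 a) ->
      frame [:: aOut; aI; aLen] st st2.
    by move=> rE nE'; split=> [|a aN]; rewrite ?rE ?nE' //; case: fr => // _ ->.
  rewrite /Inv /= bE; case pi: (p i).
    rewrite /= /update /= -/i iotaE filter_rcons pi -rcons_cat size_rcons lenE'.
    split=> //; [|lia|by rewrite addn1|].
      apply: frE => // a; rewrite !inE /=.
      by case/norP=> /negPf-> /norP[/negPf-> /negPf->].
    by rewrite -[in RHS]outE'; apply: mkseq_update.
  rewrite /= /update /= -/i iotaE filter_rcons pi; split=> //; last by lia.
  apply: frE => // a; rewrite !inE /=.
  by case/norP=> _ /norP[/negPf-> _].
rewrite /Inv /= /update /= cats0; split=> //; split=> // a; rewrite !inE /=.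
by case/norP=> _ /norP[/negPf-> _].
Qed.

End Correctness.

(** The running time is O(n + K l): loading, building and listing are linear, and
    each of the at most K extractions replays a path of length l. *)
Lemma schedule_prog_runs : exists C, forall (R : realType) (n : nat)
    (k1 k2 : nat -> R) (st : state R) (pm : R) (K l : nat),
  0 < n -> n <= 2 ^ l -> holds_keys n k1 k2 st -> max_key k1 k2 n pm pm ->
  (forall X, lightest n k1 k2 X -> (gain k1 k2 X < pm)%R ->
     size X < K /\ exists2 y, y < n & (k1 y <= k2 y)%R && (y \notin X)) ->
  runs schedule_prog st (C * (n + K.+1 * l.+1)) (fun st' => exists X,
    [/\ lightest n k1 k2 X,
        forall j, j < n -> (k1 j <= k2 j)%R -> (k1 j <= gain k1 k2 X)%R,
        (0 <= gain k1 k2 X)%R &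
        let out := (X ++ [seq j <- iota 0 n | (k1 j <= k2 j)%R && (j \notin X)])
          ++ [seq j <- iota 0 n | ~~ (k1 j <= k2 j)%R] in
        mkseq (nmem st' aOut) (size out) = out]).
Proof.
pose B := bcost (BNot (RLe (rscal rMax) (rscal rGain))).
pose P := cost pop.
pose Q := (bcost (NLe (NConst 1) (nscal aCur)) + cost replay_step).+1.
pose Cl := cost init + (bcost more_jobs + cost (Seq load_job next_job)).+1.
pose Cb := (bcost (NLe (NConst 2) (nscal aI)) + cost build_step).+1.
pose Cc b := cost (set_nscal aI (NConst 0)) + (bcost more_jobs + cost (collect_step b)).+1.
(* The factor 2 turns the n + 1 loop tests into 2 n, as n > 0. *)
exists (2 * (Cl + Cb + Cc in_tree + Cc (BNot in_A) + B + P + Q + 10)).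
move=> R n k1 k2 st pm K l n_gt0 le_nl keys pm_ok progress.
apply: (@runs_weaken _ _ _ _ _ _ _ _ (fun _ Qst => Qst) (runs_seq _)); last 1 first.
- apply: runs_weaken (leqnn _) _ (load_runs keys pm_ok) => st1.
  move=> [[keys1 i1 len1 par1 gain1] [leaves1 [mx_ge0 mx_le mx_ub]]].
  set mx := rmem st1 3 0 in mx_ge0 mx_le mx_ub.
  apply/runs_seq; apply: runs_weaken (leqnn _) _ (build_runs n_gt0 keys1 i1 par1).
  move=> st2 [fr2 [leaves2 played2 parents2]].
  have ext2 : extracting n k1 k2 mx [::] st2.
    split; split.
    + exact: frame_keys fr2 isT keys1.
    + by [].
    + by [].
    + by move=> j jn; rewrite leaves2 ?leq_addr // leaves1.
    + by [].
    + by rewrite fr2.2.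
    + by rewrite fr2.1 gain1 /gain big_nil.
    + by rewrite fr2.1.
    + by [].
  have progress_mx X : lightest n k1 k2 X -> (gain k1 k2 X < mx)%R ->
      size X < K /\ exists2 y, y < n & (k1 y <= k2 y)%R && (y \notin X).
    by move=> lX ltg; apply: progress => //; apply: lt_le_trans mx_le.
  apply/runs_seq; apply: runs_weaken (leqnn _) _ (extract_runs ext2 le_nl progress_mx).
  move=> st3 [X [[keys3 _ _ leaves3] [out3 len3 _ _ lX]] le_gain].
  apply/runs_seq.
  pose L := X ++ [seq j <- iota 0 n | (k1 j <= k2 j)%R && (j \notin X)].
  apply: runs_weaken (leqnn _) _ (@collect_runs R n k1 k2 in_tree
    (fun j => (k1 j <= k2 j)%R && (j \notin X)) X st3 keys3 len3 out3 _).
    move=> st4; rewrite -/L => -[fr4 len4 out4].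
    have keys4 := frame_keys fr4 isT keys3.
    apply: runs_weaken (leqnn _) _ (@collect_runs R n k1 k2 (BNot in_A)
      (fun j => ~~ (k1 j <= k2 j)%R) L st4 keys4 len4 out4 _).
      move=> st5 [fr5 len5 out5]; exists X; split=> //.
        by move=> j jn jA; apply: le_trans le_gain; apply: mx_ub.
      exact: le_trans le_gain.
    move=> st5 fr5 lt5; have [_ k1E k2E] := frame_keys fr5 isT keys4.
    by rewrite /= k1E k2E.
  move=> st4 fr4 lt4; have [nE _ _] := frame_keys fr4 isT keys3.
  rewrite /= nE fr4.2 // leaves3 // addn1.
  by case: ifP => // _; rewrite ltnn.
- rewrite /while_cost -/Q -/P -/B.
  set cl := (bcost more_jobs + cost (Seq load_job next_job)).+1.
  set ct := (bcost more_jobs + cost (collect_step in_tree)).+1.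
  set ca := (bcost more_jobs + cost (collect_step (BNot in_A))).+1.
  have El : cost init + cl * n.+1 <= 2 * Cl * n by rewrite /Cl -/cl; nia.
  have Eb : Cb * n.+1 <= 2 * Cb * n by nia.
  have Et : cost (set_nscal aI (NConst 0)) + ct * n.+1 <= 2 * Cc in_tree * n.
    by rewrite /Cc -/ct; nia.
  have Ea : cost (set_nscal aI (NConst 0)) + ca * n.+1 <= 2 * Cc (BNot in_A) * n.
    by rewrite /Cc -/ca; nia.
  have Ex : (B + (P + Q * l.+1).+1).+1 * K.+1 <= (B + P + Q + 2) * (K.+1 * l.+1).
    rewrite [K.+1 * l.+1]mulnC mulnA leq_mul2r; apply/orP; right; nia.
  rewrite -/Cb; move: El Eb Et Ea Ex.
  set x1 := cost init + _; set x2 := Cb * n.+1; set x3 := _ + ct * _.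
  set x4 := _ + ca * _; set x5 := _.+1 * K.+1; set y := K.+1 * l.+1.
  have : 0 < y by [].
  move: (Cc in_tree) (Cc (BNot in_A)) => c1 c2.
  clearbody x1 x2 x3 x4 x5 y Cl Cb B P Q; clear -n_gt0.
  nia.
Qed.

(** If k * k <= n, then log n <= 2 sqrt n gives k log n <= 2 n.  Otherwise
    ln n <= 2 ln k, and the hypothesis gives k log n <= (2 ln b / ln 2) n. *)
Lemma leq_mul_trunc_log (R : realType) (b : R) : (1 < b)%R -> exists c : nat,
  forall n k : nat, 0 < k <= n -> (k%:R * logb b k%:R <= n%:R :> R)%R ->
  k * trunc_log 2 n <= c * n.
Proof.
move=> b1; have lnb : (0 < ln b)%R by apply: ln_gt0.
have ln2 : (0 < ln (2 : R))%R by apply: ln_gt0; rewrite ltr1n.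
exists (Num.bound (2 * ln b / ln 2)%R + 2) => n k /andP[k0 le_kn] klog.
have n0 : 0 < n by apply: leq_trans le_kn.
set t := trunc_log 2 n.
have tn : 2 ^ t <= n by apply: trunc_logP.
have [le_kkn|lt_nkk] := leqP (k * k) n.
  have tt : t * t <= 4 * 2 ^ t.
    elim: t {tn} => // t IH; have := ltn_expl t (isT : 1 < 2); rewrite expnS; lia.
  apply: leq_trans (_ : 2 * n <= _); last by rewrite leq_mul2r leq_addl orbT.
  rewrite -leq_sqr -!mulnn mulnACA.
  by apply: leq_trans (leq_mul le_kkn (leq_trans tt (leq_mul (leqnn 4) tn))) _; lia.
have tln : (t%:R * ln 2 <= 2 * ln (k%:R : R))%R.
  have pos2 : (0 < 2 :> R)%R by rewrite ltr0n.
  have posk : (0 < k%:R :> R)%R by rewrite ltr0n.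
  rewrite (_ : t%:R * ln 2 = ln (2 ^+ t))%R; last by rewrite lnXn // mulr_natl.
  rewrite (_ : 2 * ln k%:R = ln (k%:R ^+ 2))%R; last by rewrite lnXn // mulr_natl.
  rewrite ler_ln ?posrE ?exprn_gt0 // -!natrX ler_nat.
  by apply: leq_trans tn _; rewrite -mulnn; apply: ltnW.
rewrite -(ler_nat R) !natrM natrD.
have bd : (2 * ln b / ln 2 < (Num.bound (2 * ln b / ln 2))%:R :> R)%R.
  by apply: Num.Theory.archi_boundP; rewrite divr_ge0 ?mulr_ge0 // ltW.
set M := (Num.bound _)%:R%R in bd *.
have klog' : (k%:R * ln (k%:R : R) <= n%:R * ln b)%R.
  by move: klog; rewrite /logb mulrA ler_pdivrMr.
have nR : (0 <= n%:R :> R)%R by [].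
have kR : (0 <= k%:R :> R)%R by [].
have M0 : (0 <= M)%R by rewrite /M.
rewrite -(ler_pM2r ln2) -mulrA.
apply: (@le_trans _ _ (k%:R * (2 * ln (k%:R : R)))%R); first exact: ler_wpM2l.
rewrite mulrCA.
apply: (@le_trans _ _ (2 * (n%:R * ln b))%R); first exact: ler_wpM2l.
rewrite (_ : 2 * (n%:R * ln b) = n%:R * ((2 * ln b / ln 2) * ln 2))%R; last first.
  by rewrite divfK ?gt_eqF // mulrCA.
rewrite [leRHS](_ : _ = n%:R * ((M + 2%:R) * ln 2))%R; last by rewrite -mulrA mulrCA.
rewrite ler_wpM2l // ler_wpM2r ?ltW //.
by apply: lt_le_trans bd _; rewrite lerDl.
Qed.

(** The set Y of jobs up to k_A, brought back to the original numbering: it is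
    closed downwards for p1, and this is all that the extraction needs. *)
Lemma kA_lightest (R : realType) n (I : instance R n) (sigma : {perm 'I_n})
    (k : 'I_n) :
  johnson_indexed (relabel I sigma) -> kA_condition (relabel I sigma) k ->
  exists Y : {set 'I_n}, [/\ Y \subset setA I, #|Y| <= k.+1,
    forall x y, y \in Y -> x \in setA I -> (p1 I x <= p1 I y)%R -> x \in Y
  & (pmaxA1 I <= \sum_(j in Y) (p2 I j - p1 I j))%R].
Proof.
move=> indexed kA_cond; have prefixP := kA_prefix indexed kA_cond.
have memA j : (j \in setA (relabel I sigma)) = (sigma j \in setA I) by rewrite !inE.
exists [set j in setA I | (p1 I j <= p1 I (sigma k))%R]; split.
- by apply/subsetP => j; rewrite inE => /andP[].
- rewrite -(card_imset _ (@perm_inj _ sigma^-1)).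
  apply: leq_trans (_ : #|[set j : 'I_n | j < k.+1]| <= _); last first.
    rewrite -sum1_card (eq_bigl (fun j : 'I_n => j < k.+1)) => [|j]; last by rewrite inE.
    by rewrite -(big_ord_widen _ (fun=> 1)) // sum1_card card_ord.
  apply/subset_leq_card/subsetP => j /imsetP[i]; rewrite inE => /andP[iA le_ik] ->.
  by rewrite inE ltnS -prefixP memA permKV iA /= permKV.
- move=> x y; rewrite !inE => /andP[_ yk] -> xy /=; exact: le_trans yk.
have [_ slack _] := kA_cond.
have -> : (\sum_(j in [set j in setA I | (p1 I j <= p1 I (sigma k))%R]) (p2 I j - p1 I j)
   = \sum_(j in setA (relabel I sigma) | (p1 (relabel I sigma) j <= p1 (relabel I sigma) k)%R)
     (p2 (relabel I sigma) j - p1 (relabel I sigma) j))%R.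
  rewrite (reindex_inj (@perm_inj _ sigma)) /=; apply: eq_bigl => j.
  by rewrite memA inE.
have pmE : (pmaxA1 I <= pmaxA1 (relabel I sigma))%R.
  apply: bigmax_le => [|j jA]; first exact: bigmax_ge_id.
  have -> : p1 I j = p1 (relabel I sigma) ((sigma^-1)%g j) by rewrite /= permKV.
  apply: (le_bigmax_cond _ (p1 (relabel I sigma))).
  by rewrite memA permKV.
rewrite sumrB; apply: le_trans pmE _; move: slack => /=; lra.
Qed.

Lemma map_val_exists n (X : seq nat) :
  all (fun x => x < n) X -> exists s : seq 'I_n, map val s = X.
Proof.
elim: X => [|x X IH] /=; first by exists [::].
by case/andP=> xn /IH[s <-]; exists (Ordinal xn :: s).
Qed.

(** An X containing Y would have at least the gain of Y.  So some y in Y is not in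
    X; all jobs of X are then at most as long as y, hence belong to Y. *)
Lemma kA_progress (R : realType) n (I : instance R n) (sigma : {perm 'I_n})
    (k : 'I_n) (k1 k2 : nat -> R) (X : seq nat) :
  johnson_indexed (relabel I sigma) -> kA_condition (relabel I sigma) k ->
  (forall j : 'I_n, k1 j = p1 I j) -> (forall j : 'I_n, k2 j = p2 I j) ->
  lightest n k1 k2 X -> (gain k1 k2 X < pmaxA1 I)%R ->
  size X < k.+1 /\ exists2 y, y < n & (k1 y <= k2 y)%R && (y \notin X).
Proof.
move=> indexed kA_cond k1E k2E [uX allX _ lightX] small.
have [Y [/subsetP YA cardY downY gainY]] := kA_lightest indexed kA_cond.
have [|s sE] := @map_val_exists n X.
  by apply: sub_all allX => x /andP[].
have us : uniq s by move: uX; rewrite -sE (map_inj_uniq val_inj).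
have memX (j : 'I_n) : (val j \in X) = (j \in s) by rewrite -sE (mem_map val_inj).
have sA j : j \in s -> j \in setA I.
  by rewrite -memX => /(allP allX); rewrite k1E k2E inE => /andP[].
have gainE : gain k1 k2 X = (\sum_(j in [set j in s]) (p2 I j - p1 I j))%R.
  rewrite /gain -sE big_map -big_enum /=.
  rewrite [RHS](perm_big s); first by apply: eq_bigr => j _; rewrite k1E k2E.
  by apply: uniq_perm; rewrite ?enum_uniq // => j; rewrite mem_enum inE.
have [Ys|] := boolP (Y \subset [set j in s]).
  move: small; rewrite ltNge => /negP[]; apply: le_trans gainY _.
  rewrite gainE [leRHS](big_setID Y) /= (setIidPr Ys) lerDl.
  by apply: sumr_ge0 => j; rewrite !inE => /andP[_ /sA]; rewrite inE subr_ge0.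
case/subsetPn => y yY; rewrite inE => ys.
have yA := YA y yY; split; last first.
  by exists y => //; rewrite k1E k2E memX ys andbT; move: yA; rewrite inE.
have -> : size X = #|[set j in s]| by rewrite cardsE (card_uniqP us) -sE size_map.
apply: leq_trans cardY; apply/proper_card/properP; split; last first.
  by exists y => //; rewrite inE.
apply/subsetP => j; rewrite inE => js; apply: downY yY (sA j js) _.
rewrite -!k1E; apply: lightX; rewrite ?memX //.
by rewrite k1E k2E; move: yA; rewrite inE.
Qed.

(** With l = log n + 1 and K = k_A, the time O(n + K l) is O(n). *)
Lemma linear_time_optimal (R : realType) :
  exists prog : cmd, forall b : R, (1 < b)%R -> exists c : nat,
     forall (n : nat) (I : instance R n) (sigma : {perm 'I_n}) (kA : 'I_n)
       (st : state R),
     johnson_indexed (relabel I sigma) ->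
     (total1 I <= total2 I - pmaxB2 I)%R ->
     is_kA (relabel I sigma) kA ->
     ((kA.+1)%:R * logb b (kA.+1)%:R <= n%:R)%R ->
     holds_input I st ->
     exists (t : nat) (st' : state R) (s : seq 'I_n),
       [/\ exec prog st t st', (t <= c * n)%N,
           holds_output s st' & optimal_sequence I s].
Proof.
exists schedule_prog => b b1.
have [C Cruns] := schedule_prog_runs; have [c cP] := leq_mul_trunc_log b1.
exists (C * (2 * c + 5)) => n I sigma k st indexed totals [kA_cond _] klog [nE k1E k2E].
have le_kn : k.+1 <= n by [].
have n_gt0 : 0 < n by apply: leq_trans le_kn.
set k1 := rmem st 0 in k1E; set k2 := rmem st 1 in k2E.
have keys : holds_keys n k1 k2 st by [].
pose l := (trunc_log 2 n).+1.
have le_nl : n <= 2 ^ l by apply/ltnW/trunc_log_ltn.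
have pm_ok : max_key k1 k2 n (pmaxA1 I) (pmaxA1 I).
  split=> //; first exact: bigmax_ge_id.
  move=> j jn; rewrite -[j]/(val (Ordinal jn)) k1E k2E => jA.
  by apply: (le_bigmax_cond _ (p1 I)); rewrite inE.
have [t [st' [ex le_t]]] := Cruns R n k1 k2 st (pmaxA1 I) k.+1 l n_gt0 le_nl keys pm_ok
  (fun X => @kA_progress R n I sigma k k1 k2 X indexed kA_cond k1E k2E).
move=> [X [lightX ubX gain_ge0 outX]].
have [uX allX sortX lX] := lightX.
have [|s1 sE] := @map_val_exists n X.
  by apply: sub_all allX => x /andP[].
have us : uniq s1 by move: uX; rewrite -sE (map_inj_uniq val_inj).
have memX (j : 'I_n) : (val j \in X) = (j \in s1) by rewrite -sE (mem_map val_inj).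
have sA j : j \in s1 -> j \in setA I.
  by rewrite -memX => /(allP allX); rewrite k1E k2E inE => /andP[].
pose s2 := [seq j <- enum 'I_n | (j \in setA I) && (j \notin s1)].
pose sB := [seq j <- enum 'I_n | j \in setB I].
have valF (p : pred nat) (q : pred 'I_n) : (forall j : 'I_n, p j = q j) ->
    [seq j <- iota 0 n | p j] = map val [seq j <- enum 'I_n | q j].
  by move=> pq; rewrite -val_enum_ord filter_map; congr map; apply: eq_filter.
have pA : perm_eq (s1 ++ s2) (enum (setA I)).
  apply: uniq_perm => [||j]; [|exact: enum_uniq|].
    rewrite cat_uniq us filter_uniq ?enum_uniq // andbT /=.
    by apply/hasPn => j; rewrite mem_filter => /andP[/andP[]].
  rewrite mem_cat mem_filter !mem_enum andbT.
  by have [/sA ->|_] := boolP (j \in s1); rewrite ?andbT.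
have pB : perm_eq sB (enum (setB I)).
  apply: uniq_perm => [||j]; [|exact: enum_uniq|].
    by rewrite filter_uniq ?enum_uniq.
  by rewrite mem_filter !mem_enum andbT.
have opt : optimal_sequence I (s1 ++ s2 ++ sB).
  apply: prefix_optimal => //.
  - move: sortX; rewrite -sE sorted_map; apply: sub_sorted => i j /=.
    by rewrite !k1E.
  - move=> i j; rewrite mem_filter => is1 /andP[/andP[jA js1] _].
    rewrite -!k1E; apply: lX; rewrite ?memX //.
    by rewrite k1E k2E; move: jA; rewrite inE.
  have -> : (\sum_(i <- s1) (p2 I i - p1 I i) = gain k1 k2 X)%R.
    by rewrite /gain -sE big_map; apply: eq_bigr => j _; rewrite k1E k2E.
  apply: bigmax_le => // j jA; rewrite -k1E; apply: ubX => //.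
  by rewrite k1E k2E; move: jA; rewrite inE.
exists t, st', (s1 ++ s2 ++ sB); split=> //.
(* With k = k_A and t = log n, (k + 1) (t + 2) <= 2 k t + 4 k <= (2 c + 4) n. *)
- apply: leq_trans le_t _; rewrite -mulnA leq_mul2l; apply/orP; right.
  have := cP n k.+1 _ klog; rewrite le_kn /l => /(_ isT).
  move: (trunc_log 2 n) le_kn; clear; nia.
have mapE : map val (s1 ++ s2 ++ sB) =
    (X ++ [seq j <- iota 0 n | (k1 j <= k2 j)%R && (j \notin X)])
          ++ [seq j <- iota 0 n | ~~ (k1 j <= k2 j)%R].
  rewrite !map_cat sE -catA; congr (_ ++ (_ ++ _)); apply/esym/valF => j.
    by rewrite k1E k2E memX inE.
  by rewrite k1E k2E inE ltNge.
move: outX; rewrite -mapE /= size_map.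
by rewrite (perm_size opt.1) size_enum_ord.
Qed.

Local Open Scope ring_scope.

Theorem mainTheorem4 (R : realType) :
  (forall (n : nat) (I : instance R n) (kA : 'I_n),
     johnson_indexed I ->
     total1 I <= total2 I - pmaxB2 I ->
     is_kA I kA ->
     forall sA sB : seq 'I_n,
       perm_eq sA [seq j : 'I_n <- enum (setA I) | (kA < j)%N] ->
       perm_eq sB (enum (setB I)) ->
       optimal_sequence I ([seq j : 'I_n <- enum 'I_n | (j <= kA)%N] ++ sA ++ sB))
  /\
  (exists prog : cmd, forall b : R, 1 < b -> exists c : nat,
     forall (n : nat) (I : instance R n) (sigma : {perm 'I_n}) (kA : 'I_n)
       (st : state R),
     johnson_indexed (relabel I sigma) ->
     total1 I <= total2 I - pmaxB2 I ->
     is_kA (relabel I sigma) kA ->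
     (kA.+1)%:R * logb b (kA.+1)%:R <= n%:R ->
     holds_input I st ->
     exists (t : nat) (st' : state R) (s : seq 'I_n),
       [/\ exec prog st t st', (t <= c * n)%N,
           holds_output s st' & optimal_sequence I s]).
Proof.
split; last exact: linear_time_optimal.
by move=> n I kA; apply: johnson_prefix_optimal.
Qed.
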